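(* Let $G$ be a connected graph and let $L(G)$ denote its line graph. Then (1) $\mu_3(G)\leq \tau_3(L(G))$; (2) $\mu_3(L(G))\geq \frac{1}{12}\mu_3(G)-\frac{1}{2}$; (3) $\tau_3(L(L(G)))\geq \frac{1}{4}\tau_3(G)-\frac{2}{3}$.
   Context: All graphs are finite, simple and undirected. For a graph $G$ and $S\subseteq V(G)$ with $|S|\geq 2$, an $S$-Steiner tree is a subgraph of $G$ that is a tree whose vertex set contains $S$; it is a pendant $S$-Steiner tree if every vertex of $S$ has degree exactly $1$ in the tree. Two pendant $S$-Steiner trees $T,T'$ are internally disjoint if $E(T)\cap E(T')=\varnothing$ and $V(T)\cap V(T')=S$. $\tau_G(S)$ is the maximum number of pairwise internally disjoint pendant $S$-Steiner trees in $G$, and $\mu_G(S)$ is the maximum number of pairwise edge-disjoint pendant $S$-Steiner trees in $G$. For an integer $k$ with $2\leq k\leq |V(G)|$, the pendant-tree $k$-connectivity is $\tau_k(G)=\min\{\tau_G(S): S\subseteq V(G),|S|=k\}$ and the pendant-tree $k$-edge-connectivity is $\mu_k(G)=\min\{\mu_G(S): S\subseteq V(G),|S|=k\}$. $L(G)$ is the line graph of $G$. *)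

(* Defs.v *)
From HB Require Import structures.
From mathcomp Require Import all_boot all_order all_algebra.

Set Implicit Arguments.
Unset Strict Implicit.
Unset Printing Implicit Defensive.

Record sgraph := SGraph {
  vertex :> finType;
  adj : rel vertex;
  adj_sym : symmetric adj;
  adj_irr : irreflexive adj }.

Arguments adj {s} : rename.

Definition connected_graph (G : sgraph) : Prop :=
  (0 < #|G|) /\ (forall x y : G, connect adj x y).

Definition edges (G : sgraph) : {set {set G}} :=
  [set [set p.1; p.2] | p : G * G & adj p.1 p.2].

Definition line_vertex (G : sgraph) : finType := {e : {set G} | e \in edges G}.

Definition line_adj (G : sgraph) : rel (line_vertex G) :=
  fun e f => (e != f) && (val e :&: val f != set0).

Lemma line_adj_sym (G : sgraph) : symmetric (@line_adj G).
Proof. by move=> e f; rewrite /line_adj eq_sym setIC. Qed.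

Lemma line_adj_irr (G : sgraph) : irreflexive (@line_adj G).
Proof. by move=> e; rewrite /line_adj eqxx. Qed.

Definition line_graph (G : sgraph) : sgraph :=
  SGraph (@line_adj_sym G) (@line_adj_irr G).

(* A candidate subgraph: a set of vertices and a set of edges, each edge being
   the set of its two ends. Validity is the predicate [is_subgraph]. *)
Definition subgr (G : sgraph) : finType := ({set G} * {set {set G}})%type.

Definition vset (G : sgraph) (T : subgr G) : {set G} := T.1.
Definition eset (G : sgraph) (T : subgr G) : {set {set G}} := T.2.

Definition is_subgraph (G : sgraph) (T : subgr G) : bool :=
  (eset T \subset edges G) && [forall e in eset T, e \subset vset T].

Definition sub_adj (G : sgraph) (T : subgr G) : rel G :=
  fun x y => [set x; y] \in eset T.

Definition sub_connected (G : sgraph) (T : subgr G) : bool :=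
  (vset T != set0) &&
  [forall x in vset T, forall y in vset T, connect (sub_adj T) x y].

(* No cycle of length at least 3. Its vertices being distinct, a cycle has
   length at most #|G|, which makes the property decidable; see
   [sub_acyclicP]. *)
Definition sub_acyclic (G : sgraph) (T : subgr G) : bool :=
  [forall n : 'I_#|G|.+1, forall c : n.-tuple G,
     (2 < n) ==> ~~ ucycleb (sub_adj T) c].

Lemma sub_acyclicP (G : sgraph) (T : subgr G) :
  reflect (forall c : seq G, 2 < size c -> ~ ucycle (sub_adj T) c)
          (sub_acyclic T).
Proof.
apply: (iffP forallP) => [acT c c_gt2 cyc | acT n].
  have /andP[_ uc] := cyc.
  have ltc : size c < #|G|.+1 by rewrite ltnS -(card_uniqP uc) max_card.
  have /forallP/(_ (in_tuple c)) := acT (Ordinal ltc).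
  by rewrite /= c_gt2 => /negP; apply.
apply/forallP=> c; apply/implyP=> n_gt2; apply/negP=> cyc.
by apply: (acT c) cyc; rewrite size_tuple.
Qed.

Definition is_tree (G : sgraph) (T : subgr G) : bool :=
  [&& is_subgraph T, sub_connected T & sub_acyclic T].

Definition sub_degree (G : sgraph) (T : subgr G) (x : G) : nat :=
  #|[set e in eset T | x \in e]|.

Definition steiner_tree (G : sgraph) (S : {set G}) (T : subgr G) : bool :=
  is_tree T && (S \subset vset T).

Definition pendant_steiner_tree (G : sgraph) (S : {set G}) (T : subgr G) :
  bool :=
  steiner_tree S T && [forall x in S, sub_degree T x == 1].

Definition edge_disjoint (G : sgraph) (T T' : subgr G) : bool :=
  eset T :&: eset T' == set0.

Definition internally_disjoint (G : sgraph) (S : {set G}) (T T' : subgr G) :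
  bool :=
  edge_disjoint T T' && (vset T :&: vset T' == S).

Definition pendant_packing (G : sgraph) (S : {set G}) (d : rel (subgr G))
  (P : {set subgr G}) : bool :=
  [forall T in P, pendant_steiner_tree S T] &&
  [forall T in P, forall T' in P, (T != T') ==> d T T'].

Definition tau_set (G : sgraph) (S : {set G}) : nat :=
  \max_(P : {set subgr G} | pendant_packing S (internally_disjoint S) P) #|P|.

Definition mu_set (G : sgraph) (S : {set G}) : nat :=
  \max_(P : {set subgr G} | pendant_packing S (@edge_disjoint G) P) #|P|.

(* Minimum of [f S] over the k-subsets [S] of the vertices; by convention 0
   when the graph has fewer than k vertices, so that there is no such [S]. *)
Definition min_ksubsets (G : sgraph) (k : nat) (f : {set G} -> nat) : nat :=
  if [pick S : {set G} | #|S| == k] is Some S0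
  then f [arg min_(S < S0 | #|S| == k) f S] else 0.

Lemma min_ksubsetsP (G : sgraph) (k : nat) (f : {set G} -> nat) :
  k <= #|G| ->
  (exists2 S : {set G}, #|S| = k & min_ksubsets k f = f S) /\
  (forall S : {set G}, #|S| = k -> min_ksubsets k f <= f S).
Proof.
move=> le_k; rewrite /min_ksubsets; case: pickP => [S0 cS0 | noS].
  case: arg_minnP => // S /eqP cS minS; split; first by exists S.
  by move=> S' /eqP; apply: minS.
have := card_draws G k; rewrite (@eq_card0 _ [set A : {set G} | #|A| == k]).
  by move/esym/eqP; rewrite eqn0Ngt bin_gt0 le_k.
by move=> S; rewrite inE noS.
Qed.

Definition tau (k : nat) (G : sgraph) : nat := min_ksubsets k (@tau_set G).

Definition mu (k : nat) (G : sgraph) : nat := min_ksubsets k (@mu_set G).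

(* Main.v *)
(* Let S' consist of three edges of G, and let S be a system of distinct
   representatives: a vertex v_e of every e in S'. In a pendant S-Steiner tree T
   of G, an edge e of S' lying in T must be the pendant edge at v_e. Hence the
   edges of T outside S' induce a connected subgraph of L(G), disjoint from S',
   in which every e of S' has a neighbour, except if T is a star with edge set
   S', which a suitable choice of S rules out. A spanning
   tree of this subgraph with S' attached as leaves is a pendant S'-Steiner tree,
   and edge-disjoint trees T give internally disjoint trees of L(G). This is (1).
   As tau <= mu, iterating (1) gives mu_3(G) <= mu_3(L(G)) and
   tau_3(G) <= tau_3(L(L(G))), which are stronger than (2) and (3). *)
Require Import Defs.
From mathcomp Require Import all_boot all_order all_algebra.
Import Order.TTheory GRing.Theory Num.Theory.

Set Implicit Arguments.
Unset Strict Implicit.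
Unset Printing Implicit Defensive.

(** * Connectivity and edges *)

Definition rel_in (V : finType) (A : {set V}) (r : rel V) : rel V :=
  fun x y => [&& x \in A, y \in A & r x y].

(** Induction along a path, for invariants with values in [Prop]; the later connectivity arguments
    apply it to invariants that contain existential statements. *)
Lemma connect_stable (V : finType) (r : rel V) (P : V -> Prop) (x y : V) :
  (forall a b, r a b -> P a -> P b) -> connect r x y -> P x -> P y.
Proof.
move=> stP /connectP[p rp ->]; elim: p x rp => //= z p IH x /andP[rxz rp] Px.
by apply: IH rp _; apply: stP rxz Px.
Qed.

Lemma connect_crossing (V : finType) (r : rel V) (A : {set V}) (x y : V) :
  connect r x y -> x \in A -> y \notin A ->
  exists a b, [/\ a \in A, b \notin A & r a b].
Proof.
move=> cxy xA yA.
have [/existsP[a /existsP[b /and3P[aA bA rab]]]|noab] :=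
  boolP [exists a, exists b, [&& a \in A, b \notin A & r a b]].
  by exists a, b.
case/negP: yA; apply: (@connect_stable _ r (fun z => z \in A)) cxy xA => a b rab aA.
apply/negPn/negP => bA; case/existsP: noab; exists a; apply/existsP; exists b.
by rewrite aA bA.
Qed.

Lemma edgesP (G : sgraph) (e : {set G}) :
  reflect (exists x y, adj x y /\ e = [set x; y]) (e \in edges G).
Proof.
apply: (iffP imsetP) => [[[x y]]|[x [y [axy ->]]]];
  last by exists (x, y); rewrite ?inE.
by rewrite inE /= => axy ->; exists x, y.
Qed.

Lemma edges_card (G : sgraph) (e : {set G}) : e \in edges G -> #|e| = 2.
Proof.
case/edgesP=> x [y [axy ->]]; rewrite cards2.
by rewrite (contraTneq _ axy) // => ->; rewrite adj_irr.
Qed.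

Lemma edges_adj (G : sgraph) (x y : G) : ([set x; y] \in edges G) = adj x y.
Proof.
apply/edgesP/idP => [[a [b [aab E]]]|axy]; last by exists x, y.
have ab : a != b by apply: contraTneq aab => ->; rewrite adj_irr.
have xy : x != y.
  by apply/negP=> /eqP xy; have := cards2 x y; rewrite E cards2 ab xy eqxx.
have := set21 x y; have := set22 x y; rewrite E !inE.
case/orP=> /eqP Ey; case/orP=> /eqP Ex; subst.
- by rewrite eqxx in xy.
- by rewrite adj_sym.
- by [].
- by rewrite eqxx in xy.
Qed.

(** * Growing trees leaf by leaf *)

Section TreeGrowth.
Variable G : sgraph.
Implicit Types (T : subgr G) (x y s : G) (W S : {set G}).

Definition add_leaf T x y : subgr G :=
  (y |: vset T, [set x; y] |: eset T).

Lemma sub_adj_sym T : symmetric (sub_adj T).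
Proof. by move=> x y; rewrite /sub_adj setUC. Qed.

Lemma subgraph_ends T (e : {set G}) x :
  is_subgraph T -> e \in eset T -> x \in e -> x \in vset T.
Proof. by case/andP=> _ /forall_inP/(_ e) sT eT; apply/subsetP/sT. Qed.

Lemma sub_adj_add_leaf T x y a b : y != b -> y != a ->
  sub_adj (add_leaf T x y) a b = sub_adj T a b.
Proof.
move=> yb ya; rewrite /sub_adj /= in_setU1.
case: eqP => // /setP/(_ y); rewrite !inE eqxx orbT.
by rewrite (negPf yb) (negPf ya).
Qed.

Lemma sub_adj_leaf T x y b : is_subgraph T -> y \notin vset T ->
  x != y -> sub_adj (add_leaf T x y) y b -> b = x.
Proof.
move=> sT yT xy; rewrite /sub_adj /= in_setU1 => /orP[/eqP/setP/(_ x)|eT].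
  by rewrite !inE eqxx (negPf xy) /= => /eqP.
by case/negP: yT; apply: subgraph_ends eT _ => //; rewrite set21.
Qed.

(** Every vertex of the new tree reaches [x], which gives connectedness. A cycle must use [y], since
    [T] is acyclic, but [x] is the only neighbour of [y]. *)
Lemma tree_add_leaf T x y : is_tree T -> x \in vset T -> y \notin vset T ->
  adj x y -> is_tree (add_leaf T x y).
Proof.
case/and3P=> sT /andP[_ cT] /sub_acyclicP aT xT yT axy.
have xy : x != y by apply: contraTneq axy => ->; rewrite adj_irr.
apply/and3P; split.
- have /andP[eT _] := sT; apply/andP; split.
    by apply/subsetP=> e /setU1P[->|/(subsetP eT)//]; rewrite edges_adj.
  apply/forall_inP=> e /setU1P[->|eT'].
    by apply/subsetP=> z /set2P[]->; rewrite !inE ?eqxx ?xT ?orbT.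
  apply/subsetP=> z ze; apply/setU1P; right; exact: subgraph_ends eT' ze.
- have sy : connect_sym (sub_adj (add_leaf T x y)).
    exact/sym_connect_sym/sub_adj_sym.
  have toX z : z \in vset (add_leaf T x y) -> connect (sub_adj (add_leaf T x y)) z x.
    case/setU1P=> [->|zT].
      by apply: connect1; rewrite /sub_adj /= setUC setU11.
    have /forall_inP/(_ x xT) := forall_inP cT z zT.
    apply: connect_sub => a b ab; apply: connect1.
    by rewrite /sub_adj /=; apply/setU1P; right.
  apply/andP; split; first by apply/set0Pn; exists y; rewrite setU11.
  apply/forall_inP=> a aT'; apply/forall_inP=> b bT'.
  by apply: connect_trans (toX a aT') _; rewrite sy toX.
- apply/sub_acyclicP => c c2 /andP[cyc uc].
  have [yc|yc] := boolP (y \in c); last first.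
    apply: (aT c c2); apply/andP; split=> //.
    rewrite -(@eq_in_cycle _ (predC1 y) (sub_adj (add_leaf T x y))) //.
      by move=> a b /= ay yb; apply: sub_adj_add_leaf; rewrite eq_sym.
    by apply/allP=> z zc /=; apply: contraNneq yc => <-.
  case/rot_to: yc => i c' Ec.
  have {}c2 : 2 < size (y :: c') by rewrite -Ec size_rot.
  have {}uc : uniq (y :: c') by rewrite -Ec rot_uniq.
  have {cyc} : cycle (sub_adj (add_leaf T x y)) (y :: c') by rewrite -Ec rot_cycle.
  (* The cycle is rotated to start at [y]. Its second vertex [z] and its last vertex [w] are both
     neighbours of [y], hence both equal to [x], which contradicts distinctness. *)
  case: c' c2 uc {Ec} => [|z c'] //; case/lastP: c' => [|c' w] // _ uc.
  rewrite /= rcons_path last_rcons => /and3P[yz _].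
  rewrite sub_adj_sym => /(sub_adj_leaf sT yT xy) wx.
  move/(sub_adj_leaf sT yT xy): yz => zx.
  by move: uc; rewrite /= zx wx mem_rcons !inE eqxx /= andbF.
Qed.

Lemma tree_set1 x : is_tree (([set x], set0) : subgr G).
Proof.
apply/and3P; split.
- by rewrite /is_subgraph sub0set /=; apply/forall_inP=> e; rewrite inE.
- apply/andP; split; first by apply/set0Pn; exists x; rewrite set11.
  by apply/forall_inP=> a /set1P->; apply/forall_inP=> b /set1P->; apply: connect0.
- apply/sub_acyclicP=> [[|a [|b c]]] // _ /andP[/= /andP[]].
  by rewrite /sub_adj inE.
Qed.

(** A tree inside [W] with the most vertices spans [W]: otherwise an edge of [W] leaves its vertex
    set, and attaching that edge gives a larger tree. *)
Lemma spanning_tree W : W != set0 ->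
  {in W &, forall x y, connect (rel_in W adj) x y} ->
  exists2 T, is_tree T & vset T = W.
Proof.
case/set0Pn=> x0 x0W cW.
have T0 : is_tree (([set x0], set0) : subgr G) && ([set x0] \subset W).
  by rewrite tree_set1 sub1set.
case: (@arg_maxnP _ ([set x0], set0)
   (fun T => is_tree T && (vset T \subset W)) (fun T => #|vset T|) T0).
move=> T /andP[tT TW] maxT; exists T => //; apply/eqP; rewrite eqEsubset TW /=.
apply/subsetP=> y yW; apply/negPn/negP => yT.
have /and3P[_ /andP[/set0Pn[x xT] _] _] := tT.
have [|//|//|a [b [aT bT /and3P[_ bW ab]]]] :=
  @connect_crossing _ (rel_in W adj) (vset T) x y.
  by apply: cW => //; apply: subsetP xT.
have := maxT (add_leaf T a b).
rewrite tree_add_leaf //= subUset sub1set bW TW /= => /(_ isT).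
by rewrite /vset /= cardsU1 bT ltnn.
Qed.

Lemma degree_add_leaf T x y s : s != x -> s != y ->
  sub_degree (add_leaf T x y) s = sub_degree T s.
Proof.
move=> sx sy; apply: eq_card => e; rewrite !inE.
case: eqP => //= ->; rewrite !inE (negPf sx) (negPf sy) andbF //.
Qed.

Lemma degree_new_leaf T x y : is_subgraph T -> y \notin vset T ->
  sub_degree (add_leaf T x y) y = 1.
Proof.
move=> sT yT; rewrite -(cards1 [set x; y]); apply: eq_card => e; rewrite !inE.
case: eqP => [->|_] /=; first by rewrite !inE eqxx orbT.
by apply: contraNF yT => /andP[]; apply: subgraph_ends.
Qed.

(** The elements of [S] are attached one at a time as leaves to a spanning tree of [W]. The last
    clause, that no edge avoids [W], later makes trees over disjoint sets [W] edge-disjoint. *)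
Lemma pendant_tree_of_connected W S :
  W != set0 -> {in W &, forall x y, connect (rel_in W adj) x y} ->
  [disjoint W & S] -> {in S, forall s, exists2 w, w \in W & adj w s} ->
  exists T, [/\ pendant_steiner_tree S T, vset T = W :|: S
              & {in eset T, forall e : {set G}, ~~ [disjoint e & W]}].
Proof.
move=> W0 cW dWS aWS.
suff [T [tT vT dT eT]] : exists T, [/\ is_tree T, vset T = W :|: S,
    {in S, forall s, sub_degree T s = 1}
    & {in eset T, forall e : {set G}, ~~ [disjoint e & W]}].
  exists T; split=> //; rewrite /pendant_steiner_tree /steiner_tree tT vT subsetUr.
  by apply/forall_inP=> s /dT->.
move: {2}#|S| (erefl #|S|) => n cS; elim: n S cS dWS aWS => [|n IH] S cS dWS aWS.
  have [T tT vT] := spanning_tree W0 cW.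
  have S0 : S = set0 by apply/eqP; rewrite -cards_eq0 cS.
  exists T; rewrite S0 setU0; split=> // [s|e eT]; first by rewrite inE.
  have /and3P[/andP[eG sT] _ _] := tT.
  have /edgesP[x [y [_ Ee]]] := subsetP eG e eT.
  apply/pred0Pn; exists x; rewrite /= {1}Ee set21 -vT /=.
  by apply: subsetP (forall_inP sT e eT) _ _; rewrite Ee set21.
have [y yS] : exists y, y \in S by apply/set0Pn; rewrite -cards_eq0 cS.
have sub : S :\ y \subset S by rewrite subD1set.
have [|||T [tT vT dT eT]] := IH (S :\ y).
- by move: cS; rewrite (cardsD1 y) yS => -[].
- by rewrite disjoint_sym (disjointWl sub) // disjoint_sym.
- by move=> s /(subsetP sub)/aWS.
have [x xW axy] := aWS y yS.
have yW : y \notin W by rewrite (disjointFl dWS yS).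
have yT : y \notin vset T by rewrite vT !inE eqxx (negPf yW).
exists (add_leaf T x y); split.
- by apply: tree_add_leaf => //; rewrite vT inE xW.
- by rewrite /vset /= -/(vset T) vT setUCA setD1K.
- move=> s sS; have [->|sy] := eqVneq s y.
    by apply: degree_new_leaf => //; case/and3P: tT.
  rewrite degree_add_leaf //; first by apply: dT; rewrite !inE sy.
  by apply: contraTneq xW => <-; rewrite (disjointFl dWS sS).
- move=> e /setU1P[->|/eT//]; apply/pred0Pn; exists x.
  by rewrite /= set21 xW.
Qed.

End TreeGrowth.

(** * The inner vertices of a pendant Steiner tree *)

Section PendantTree.
Variables (G : sgraph) (S : {set G}) (T : subgr G).
Hypotheses (S2 : 2 < #|S|) (pT : pendant_steiner_tree S T).

Lemma pendant_subgraph : is_subgraph T.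
Proof. by case/andP: pT => /andP[/and3P[]]. Qed.

Lemma pendant_connect : {in vset T &, forall x y, connect (sub_adj T) x y}.
Proof.
case/andP: pT => /andP[/and3P[_ /andP[_ cT] _] _] _ x y xT yT.
exact: forall_inP (forall_inP cT x xT) y yT.
Qed.

Lemma pendant_sub s : s \in S -> s \in vset T.
Proof. by case/andP: pT => /andP[_ /subsetP ST] _ /ST. Qed.

Lemma pendant_edge_uniq s (e f : {set G}) :
  s \in S -> e \in eset T -> f \in eset T -> s \in e -> s \in f -> e = f.
Proof.
move=> sS eT fT se sf; case/andP: pT => _ /forall_inP/(_ s sS)/cards1P[g Eg].
have : e \in [set g] by rewrite -Eg inE eT.
have : f \in [set g] by rewrite -Eg inE fT.
by move=> /set1P-> /set1P->.
Qed.

Lemma pendant_nbr_uniq s x y :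
  s \in S -> sub_adj T s x -> sub_adj T s y -> x = y.
Proof.
move=> sS sx sy.
have E := pendant_edge_uniq sS sx sy (set21 _ _) (set21 _ _).
have xs : s != x.
  have := subsetP (andP pendant_subgraph).1 _ sx; rewrite edges_adj.
  by apply: contraTneq => ->; rewrite adj_irr.
have : x \in [set s; y] by rewrite -E set22.
by case/set2P => // Ex; rewrite Ex eqxx in xs.
Qed.

Lemma sub_adj_vset x y : sub_adj T x y -> y \in vset T.
Proof. by move/(subgraph_ends pendant_subgraph); apply; rewrite set22. Qed.

(** If the only neighbour [u] of [s] were in [S], then [s] and [u] would form a whole component of
    [T], leaving no room for a third element of [S]. *)
Lemma pendant_nbr s : s \in S ->
  exists2 u, u \in vset T :\: S & sub_adj T s u.
Proof.
move=> sS; have := pT => /andP[_ /forall_inP/(_ s sS)/cards1P[g Eg]].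
have : g \in [set g] by rewrite set11.
rewrite -Eg inE => /andP[gT sg].
have [u gE] : exists u, g = [set s; u].
  have /edgesP[a [b [_ E]]] := subsetP (andP pendant_subgraph).1 g gT.
  move: sg; rewrite E => /set2P[->|->]; first by exists b.
  by exists a; rewrite setUC.
have su : sub_adj T s u by rewrite /sub_adj -gE.
exists u => //; rewrite inE (sub_adj_vset su) andbT; apply/negP=> uS.
suff sS2 : S \subset [set s; u].
  by have := leq_trans S2 (subset_leq_card sS2); rewrite cards2; case: eqP.
apply/subsetP=> z zS; have := pendant_connect (pendant_sub sS) (pendant_sub zS).
move=> /(@connect_stable _ _ (fun z => z \in [set s; u])); apply; last exact: set21.
move=> a b ab /set2P[] Ea; subst a.
  by rewrite (pendant_nbr_uniq sS ab su) set22.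
by move: su; rewrite sub_adj_sym => /(pendant_nbr_uniq uS ab)->; rewrite set21.
Qed.

(** A path that enters a vertex of [S] must leave it through the same neighbour, so such detours can
    be cut out. *)
Lemma pendant_core_connect :
  {in vset T :\: S &, forall x y, connect (rel_in (vset T :\: S) (sub_adj T)) x y}.
Proof.
move=> x y xU yU; set U := vset T :\: S; set r := rel_in U _.
(* The invariant along a path of [T]: an inner vertex is itself reached inside [U], and for a vertex
   of [S] its neighbour is. *)
pose P z := (z \in U -> connect r x z) /\
            (z \in S -> exists2 u, connect r x u & sub_adj T z u).
suff [/(_ yU)] : P y by [].
have [[xT _] [yT _]] : (x \in vset T /\ x \in U) /\ (y \in vset T /\ y \in U).
  by move: (xU) (yU) => /setDP[-> _] /setDP[-> _].
apply: connect_stable (pendant_connect xT yT) _; last first.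
  by split=> [_|xS]; [exact: connect0|move: xU; rewrite inE xS].
move=> a b ab [PaU PaS].
have aT : a \in vset T by move: ab; rewrite sub_adj_sym => /sub_adj_vset.
have bT := sub_adj_vset ab.
have [aS|aS] := boolP (a \in S).
  have [u xu au] := PaS aS; rewrite (pendant_nbr_uniq aS ab au).
  split=> // uS; have [w wU aw] := pendant_nbr aS.
  by move: wU; rewrite -(pendant_nbr_uniq aS au aw) inE uS.
have aU : a \in U by rewrite inE aS.
split=> [bU|bS]; last by exists a; [exact: PaU|rewrite sub_adj_sym].
by apply: connect_trans (PaU aU) _; apply: connect1; rewrite /r /rel_in aU bU.
Qed.

(** * Edges of a pendant tree as vertices of the line graph *)

Variables (S' : {set line_graph G}) (rep : line_graph G -> G).
Hypotheses (repS : rep @: S' = S) (repP : {in S', forall e, rep e \in val e})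
  (repI : {in S' &, injective rep})
  (nostar : forall u, u \notin S -> exists2 e, e \in S' & val e != [set rep e; u]).

Definition line_core : {set line_graph G} :=
  [set e : line_graph G | val e \in eset T] :\: S'.

Lemma line_coreE (e : line_graph G) :
  (e \in line_core) = (e \notin S') && (val e \in eset T).
Proof. by rewrite !inE. Qed.

Lemma rep_in e : e \in S' -> rep e \in S.
Proof. by move=> eS; rewrite -repS imset_f. Qed.

Lemma line_edge (e : {set G}) : e \in eset T ->
  {f : line_graph G | val f = e}.
Proof.
move=> eT; have eG := subsetP (andP pendant_subgraph).1 e eT.
by exists (Sub e eG : line_vertex G); rewrite SubK.
Qed.

Lemma edge_meets_core (e : {set G}) : e \in eset T ->
  exists2 u, u \in vset T :\: S & u \in e.
Proof.
move=> eT; have /edgesP[a [b [_ E]]] := subsetP (andP pendant_subgraph).1 e eT.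
have [aS|aS] := boolP (a \in S).
  have [u uU au] := pendant_nbr aS; exists u => //.
  by rewrite (pendant_edge_uniq aS eT au _ (set21 _ _)) ?set22 // E set21.
exists a; last by rewrite E set21.
by rewrite inE aS (subgraph_ends pendant_subgraph eT) // E set21.
Qed.

(** An edge of [S'] contains its representative, which lies in [S]; an edge with both ends outside
    [S] is therefore not in [S']. *)
Lemma core_edge_line x y : x \in vset T :\: S -> y \in vset T :\: S ->
  sub_adj T x y -> exists2 f, f \in line_core & val f = [set x; y].
Proof.
move=> /setDP[_ xS] /setDP[_ yS] xy; have [f fE] := line_edge xy.
exists f => //; rewrite line_coreE fE (xy : [set x; y] \in eset T) andbT.
apply/negP=> fS; have := repP fS; rewrite fE => /set2P[] E.
  by rewrite -E rep_in in xS.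
by rewrite -E rep_in in yS.
Qed.

Lemma line_connect1 (e f : line_graph G) x : e \in line_core -> f \in line_core ->
  x \in val e -> x \in val f -> connect (rel_in line_core adj) e f.
Proof.
move=> eW fW xe xf; have [->|ef] := eqVneq e f; first exact: connect0.
apply: connect1; rewrite /rel_in eW fW /= /line_adj ef /=.
by apply/set0Pn; exists x; rewrite inE xe.
Qed.

(** Each of the two edges has an end outside [S]. The edges of a path joining these ends outside [S]
    all belong to [line_core], and consecutive ones share a vertex. *)
Lemma line_core_connect :
  {in line_core &, forall e f, connect (rel_in line_core adj) e f}.
Proof.
move=> e f eW fW.
have /andP[_ /edge_meets_core[u uU ue]] : (e \notin S') && (val e \in eset T).
  by rewrite -line_coreE.
have /andP[_ /edge_meets_core[v vU vf]] : (f \notin S') && (val f \in eset T).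
  by rewrite -line_coreE.
pose P z := exists g,
  [/\ g \in line_core, z \in val g & connect (rel_in line_core adj) e g].
suff [g [gW vg eg]] : P v by apply: connect_trans eg (line_connect1 gW fW vg vf).
apply: connect_stable (pendant_core_connect uU vU) _; last by exists e.
move=> a b /and3P[aU bU ab] [g [gW ag eg]].
have [h hW hE] := core_edge_line aU bU ab.
exists h; rewrite hE set22; split=> //.
by apply: connect_trans eg (line_connect1 gW hW ag _); rewrite hE set21.
Qed.

Lemma line_adjI (e f : line_graph G) x : e != f -> x \in val e -> x \in val f ->
  adj e f.
Proof.
by move=> ef xe xf; rewrite /= /line_adj ef; apply/set0Pn; exists x; rewrite inE xe.
Qed.

(** The natural neighbour of [e] is the pendant edge of [T] at [rep e]. It fails only when it is [e]
    itself; another core edge at its inner end [u] is then needed, and [nostar] provides one. *)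
Lemma line_core_adj :
  {in S', forall s, exists2 w, w \in line_core & adj w s}.
Proof.
move=> e eS; have [u uU eu] := pendant_nbr (rep_in eS).
have uS : u \notin S by case/setDP: uU.
have [f fE] := line_edge eu.
have [fS|fS] := boolP (f \in S'); last first.
  have fe : f != e by apply: contraNneq fS => ->.
  exists f; first by rewrite line_coreE fS fE.
  by apply: (line_adjI fe (x := rep e)); rewrite ?fE ?set21 ?repP.
(* The representative of [f] is [rep e] or [u]. As [u] is not in [S], it is [rep e], and injectivity
   applies. *)
have {fS} Ef : f = e.
  apply: repI => //; have := repP fS; rewrite fE => /set2P[] // E.
  by rewrite -E rep_in in uS.
move: fE; rewrite Ef => eE {f Ef}.
have [g gS gu] := nostar uS.
suff [h hW uh] : exists2 h, h \in line_core & u \in val h.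
  exists h => //; apply: line_adjI uh _; last by rewrite eE set22.
  by apply: contraTneq eS => <-; move: hW; rewrite line_coreE => /andP[].
have [v vU gv] := pendant_nbr (rep_in gS).
(* If the pendant edge at [rep g] ends in [u], it differs from [g] by the choice of [g], so it is a
   core edge. Otherwise the first edge of an inner path from [u] to [v] serves. *)
have [Euv|uv] := eqVneq u v.
  have [h hE] := line_edge gv; exists h; last by rewrite hE Euv set22.
  rewrite line_coreE hE (gv : [set rep g; v] \in eset T) andbT; apply/negP=> hS.
  have Eh : h = g.
    apply: repI => //; have := repP hS; rewrite hE => /set2P[] // E.
    by rewrite Euv -E rep_in in uS.
  by rewrite -Eh hE Eh Euv eqxx in gu.
have [||a [b [/set1P-> _ /and3P[_ bU ub]]]] :=
  @connect_crossing _ _ [set u] _ _ (pendant_core_connect uU vU).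
- exact: set11.
- by rewrite inE eq_sym.
have [h hW hE] := core_edge_line uU bU ub.
by exists h; rewrite // hE set21.
Qed.

Lemma line_core_neq0 : line_core != set0.
Proof.
have [s sS] : exists s, s \in S by apply/set0Pn; rewrite -card_gt0 (leq_trans _ S2).
have : s \in rep @: S' by rewrite repS.
case/imsetP=> e /line_core_adj[w wW _] _.
by apply/set0Pn; exists w.
Qed.

Lemma pendant_line_tree : exists T' : subgr (line_graph G),
  [/\ pendant_steiner_tree S' T', vset T' = line_core :|: S'
    & {in eset T', forall e : {set line_graph G}, ~~ [disjoint e & line_core]}].
Proof.
apply: pendant_tree_of_connected; first exact: line_core_neq0.
- exact: line_core_connect.
- by rewrite -setI_eq0 /line_core setDE -setIA (setIC (~: _)) setICr setI0.
- exact: line_core_adj.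
Qed.

End PendantTree.

(** * From edge-disjoint packings to internally disjoint ones *)

Lemma packingP (G : sgraph) (S : {set G}) (d : rel (subgr G)) (P : {set subgr G}) :
  reflect ({in P, forall T, pendant_steiner_tree S T} /\
           {in P &, forall T T', T != T' -> d T T'})
          (pendant_packing S d P).
Proof.
apply: (iffP andP) => [[/forall_inP PS /forall_inP Pd]|[PS Pd]]; split.
- exact: PS.
- by move=> T T' TP T'P; have /forall_inP/(_ T' T'P)/implyP := Pd T TP.
- exact/forall_inP.
- by apply/forall_inP=> T TP; apply/forall_inP=> T' T'P; apply/implyP/Pd.
Qed.

(** Edge-disjoint trees have disjoint cores, so the trees built over these cores meet only in [S'].
    They share no edge, because each edge has an end in the core of its own tree. *)
Lemma mu_set_le_tau_set_line (G : sgraph) (S' : {set line_graph G})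
    (rep : line_graph G -> G) :
  2 < #|S'| -> {in S', forall e, rep e \in val e} -> {in S' &, injective rep} ->
  (forall u, u \notin rep @: S' -> exists2 e, e \in S' & val e != [set rep e; u]) ->
  mu_set (rep @: S') <= tau_set S'.
Proof.
move=> S'2 repP repI nostar; apply/bigmax_leqP => P /packingP[PS Pd].
have S2 : 2 < #|rep @: S'| by rewrite card_in_imset.
have /fin_all_exists[F FP] : forall T : subgr G, exists T' : subgr (line_graph G),
    T \in P -> [/\ pendant_steiner_tree S' T', vset T' = line_core T S' :|: S'
    & {in eset T', forall e : {set line_graph G}, ~~ [disjoint e & line_core T S']}].
  (* The empty pair is a dummy value outside [P], which makes [F] a total function. *)
  move=> T; have [TP|_] := boolP (T \in P); last by exists (set0, set0).
  have [T' HT'] := pendant_line_tree S2 (PS T TP) (erefl _) repP repI nostar.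
  by exists T'.
have dW T T' : T \in P -> T' \in P -> T != T' ->
    [disjoint line_core T S' & line_core T' S'].
  move=> TP T'P /(Pd _ _ TP T'P) /eqP d0.
  apply/pred0P=> e; rewrite /= !line_coreE; apply/negP=> /andP[/andP[_ eT] /andP[_ eT']].
  by have : val e \in eset T :&: eset T' by [rewrite inE eT]; rewrite d0 inE.
have WS T : [disjoint line_core T S' & S'].
  by apply/pred0P=> e; rewrite /= line_coreE; case: (e \in S'); rewrite ?andbF.
(* Injectivity keeps the size of the packing. It holds because the cores are nonempty, pairwise
   disjoint and disjoint from [S']. *)
have FI : {in P &, injective F}.
  move=> T T' TP T'P E; apply/eqP/negPn/negP => /(dW T T' TP T'P) dTT'.
  have := line_core_neq0 S2 (PS T TP) (erefl _) repP repI nostar.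
  case/set0Pn=> e eW; have [_ vT _] := FP T TP; have [_ vT' _] := FP T' T'P.
  have : e \in vset (F T) by rewrite vT inE eW.
  by rewrite E vT' inE (disjointFr dTT' eW) (disjointFr (WS T) eW).
rewrite -(card_in_imset FI); apply: leq_bigmax_cond; apply/packingP; split.
  by move=> _ /imsetP[T TP ->]; case: (FP T TP).
move=> _ _ /imsetP[T TP ->] /imsetP[T' T'P ->] FTT'.
have TT' : T != T' by apply: contraNneq FTT' => ->.
have [_ vT eT] := FP T TP; have [pT' vT' eT'] := FP T' T'P.
have dTT' := dW _ _ TP T'P TT'.
have vI : vset (F T) :&: vset (F T') = S'.
  by rewrite vT vT' -setUIl (disjoint_setI0 dTT') set0U.
rewrite /internally_disjoint vI eqxx andbT; apply/eqP/setP=> e; rewrite !inE.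
apply/negP=> /andP[eF eF']; have /pred0Pn[w /andP[/= we wW]] := eT e eF.
have wT' := subgraph_ends (pendant_subgraph pT') eF' we.
by move: wT'; rewrite vT' inE (disjointFr dTT' wW) (disjointFr (WS T) wW).
Qed.

(* Cyclically choosing [v_i] in [e_i :\: e_(i+1)] gives distinct
   representatives; if the edges form a star at [u] with leaves [v_i],
   replacing one [v_i] by [u] avoids the forbidden configuration. *)
Lemma nonstar_representatives (G : sgraph) (S' : {set line_graph G}) :
  #|S'| = 3 -> exists rep : line_graph G -> G,
  [/\ {in S', forall e, rep e \in val e}, {in S' &, injective rep}
    & forall u, u \notin rep @: S' ->
        exists2 e, e \in S' & val e != [set rep e; u]].
Proof.
move=> S3; have [e1 [e2 [e3 [[e1S e2S e3S] [e12 e23 e31]]]]] : exists x y z,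
    [/\ x \in S', y \in S' & z \in S'] /\ [/\ x != y, y != z & z != x].
  by apply/card_gt2P; rewrite S3.
have S'E : S' = [set e1; e2; e3].
  apply/esym/eqP; rewrite eqEcard S3 !subUset !sub1set e1S e2S e3S /=.
  by rewrite -setUA cardsU1 cards2 !inE (negPf e12) (eq_sym e1) (negPf e31) e23.
have diff (e f : line_graph G) : e != f -> exists2 x, x \in val e & x \notin val f.
  move=> ef; apply/subsetPn; apply: contra ef => sef.
  by rewrite -val_eqE eqEcard sef !edges_card ?(valP e) ?(valP f).
have [v1 v1e v1f] := diff e1 e2 e12.
have [v2 v2e v2f] := diff e2 e3 e23.
have [v3 v3e v3f] := diff e3 e1 e31.
have v12 : v1 != v2 by apply: contraNneq v1f => ->.
have v23 : v2 != v3 by apply: contraNneq v2f => ->.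
have v31 : v3 != v1 by apply: contraNneq v3f => ->.
pose rep x y z (e : line_graph G) := if e == e1 then x
  else if e == e2 then y else z : G.
have r1 x y z : rep x y z e1 = x by rewrite /rep eqxx.
have r2 x y z : rep x y z e2 = y by rewrite /rep eq_sym (negPf e12) eqxx.
have r3 x y z : rep x y z e3 = z by rewrite /rep (negPf e31) eq_sym (negPf e23).
have build x y z : x \in val e1 -> y \in val e2 -> z \in val e3 ->
    x != y -> y != z -> z != x ->
    {in S', forall e, rep x y z e \in val e} /\ {in S' &, injective (rep x y z)}.
  move=> xe ye ze xy yz zx; rewrite S'E; split.
    by move=> e; rewrite !inE -orbA => /or3P[]/eqP->; rewrite ?r1 ?r2 ?r3.
  move=> e f; rewrite !inE -!orbA => /or3P[]/eqP-> /or3P[]/eqP->;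
    rewrite ?r1 ?r2 ?r3 // => E; move: xy yz zx; rewrite E ?eqxx //.
have [/existsP[u /and4P[uN /eqP E1 /eqP E2 /eqP E3]]|nst] := boolP [exists u,
   [&& u \notin [set v1; v2; v3], val e1 == [set v1; u], val e2 == [set v2; u]
     & val e3 == [set v3; u]]].
  have /and3P[u1 u2 u3] : [&& u != v1, u != v2 & u != v3].
    by move: uN; rewrite !inE !negb_or -andbA.
  have [] := build u v2 v3; rewrite ?E1 ?E2 ?E3 ?set21 ?set22 // 1?eq_sym //.
  move=> repP repI; exists (rep u v2 v3); split=> // w wN; exists e2 => //.
  rewrite r2 E2; apply: contraNneq wN => /setP/(_ u).
  rewrite !inE eqxx orbT (negPf u2) => /esym/eqP <-.
  by rewrite -{1}(r1 u v2 v3) imset_f.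
have [repP repI] := build v1 v2 v3 v1e v2e v3e v12 v23 v31.
exists (rep v1 v2 v3); split=> // u uN.
apply/exists_inP; apply: contraNT nst => /exists_inPn all.
apply/existsP; exists u.
have H e : e \in S' -> val e == [set rep v1 v2 v3 e; u] by move/all; rewrite negbK.
have := H e1 e1S; have := H e2 e2S; have := H e3 e3S; rewrite r1 r2 r3 => -> -> ->.
rewrite !andbT; apply: contra uN; rewrite !inE -orbA.
move=> /or3P[]/eqP->.
- by rewrite -{1}(r1 v1 v2 v3) imset_f.
- by rewrite -{1}(r2 v1 v2 v3) imset_f.
- by rewrite -{1}(r3 v1 v2 v3) imset_f.
Qed.

(** * Passing to the minimum over vertex sets *)

Lemma min_ksubsets_small (G : sgraph) k (f : {set G} -> nat) :
  #|G| < k -> min_ksubsets k f = 0.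
Proof.
move=> Gk; rewrite /min_ksubsets; case: pickP => // S /eqP kS.
by have := leq_trans Gk (eq_leq (esym kS)); rewrite ltnNge max_card.
Qed.

(** A pendant tree on a triple has three distinct pendant edges. Thus [tau 3 (line_graph G)] is a
    genuine minimum and not the default 0. *)
Lemma mu_gt0_line_card (G : sgraph) : 0 < mu 3 G -> 3 <= #|line_graph G|.
Proof.
have [G3|G3] := ltnP #|G| 3; first by rewrite /mu min_ksubsets_small.
have [[S S3 muS] _] := min_ksubsetsP (@mu_set G) G3.
rewrite /mu muS lt0n => mu0; have [P /packingP[PS _] P0] : exists2 P,
    pendant_packing S (@edge_disjoint G) P & 0 < #|P|.
  apply/exists_inP; apply: contraR mu0 => /exists_inPn noP.
  rewrite -leqn0; apply/bigmax_leqP=> P /noP; by rewrite -leqNgt.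
have [T /PS pT] : exists T, T \in P by apply/set0Pn; rewrite -card_gt0.
have S2 : 2 < #|S| by rewrite S3.
have /fin_all_exists[f fP] s : exists e : {set G}, s \in S ->
    e \in edges G /\ exists2 u, u \notin S & e = [set s; u].
  have [sS|_] := boolP (s \in S); last by exists set0.
  have [u /setDP[_ uS] su] := pendant_nbr S2 pT sS.
  exists [set s; u] => _; split; last by exists u.
  exact: subsetP (andP (pendant_subgraph pT)).1 _ su.
(* The map [f] is injective on [S], since the second end of each chosen edge lies outside [S]. *)
rewrite card_sig -S3 -(@card_in_imset _ _ f S).
  by apply/subset_leq_card/subsetP=> _ /imsetP[s /fP[eG _] ->].
move=> s t sS tS E; have [_ [u uS Es]] := fP s sS; have [_ [v vS Et]] := fP t tS.
have : s \in [set t; v] by rewrite -Et -E Es set21.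
by case/set2P => // sv; rewrite -sv sS in vS.
Qed.

(** For [S'] minimising [tau_set], the representatives form a triple of [G], whose [mu_set] bounds
    [mu 3 G] from above. *)
Lemma mu_le_tau_line (G : sgraph) : mu 3 G <= tau 3 (line_graph G).
Proof.
(* The case 0 is split off because the line graph may then have fewer than three vertices. *)
have [->//|mu0] := posnP (mu 3 G).
have [[S' S3 tauS] _] :=
  min_ksubsetsP (@tau_set (line_graph G)) (mu_gt0_line_card mu0).
rewrite /tau tauS.
have [rep [repP repI nostar]] := nonstar_representatives S3.
apply: leq_trans (mu_set_le_tau_set_line _ repP repI nostar); last by rewrite S3.
have rS3 : #|rep @: S'| = 3 by rewrite card_in_imset.
have [|_] := @min_ksubsetsP G 3 (@mu_set G); last exact.
by rewrite -rS3 max_card.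
Qed.

Lemma tau_set_le_mu_set (G : sgraph) (S : {set G}) : tau_set S <= mu_set S.
Proof.
apply/bigmax_leqP=> P /packingP[PS Pd]; apply: leq_bigmax_cond; apply/packingP.
by split=> // T T' TP T'P /(Pd T T' TP T'P)/andP[].
Qed.

Lemma tau_le_mu (G : sgraph) k : tau k G <= mu k G.
Proof.
have [Gk|Gk] := ltnP #|G| k; first by rewrite /tau min_ksubsets_small.
have [[S kS muS] _] := min_ksubsetsP (@mu_set G) Gk.
rewrite /mu muS; apply: leq_trans (tau_set_le_mu_set S).
by have [_] := min_ksubsetsP (@tau_set G) Gk; apply.
Qed.

(** * The numerical bounds *)

Unset Implicit Arguments.
Local Open Scope ring_scope.

(** A slope at most 1 and a nonnegative subtracted constant only weaken [m <= n]. *)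
Lemma affine_le_of_leq (a b : rat) (m n : nat) : a <= 1 -> 0 <= b ->
  (m <= n)%N -> a * m%:R - b <= n%:R.
Proof.
move=> a1 b0 mn; rewrite lerBlDr (le_trans _ (_ : n%:R <= _)) ?lerDl //.
by rewrite (le_trans (ler_wpM2r _ a1)) ?ler0n // mul1r ler_nat.
Qed.

Theorem theorem3p1 (G : sgraph) (hG : connected_graph G) :
  [/\ (mu 3 G <= tau 3 (line_graph G))%N,
      (mu 3 (line_graph G))%:R >= 1 / 12%:R * (mu 3 G)%:R - 1 / 2%:R :> rat
    & (tau 3 (line_graph (line_graph G)))%:R
        >= 1 / 4%:R * (tau 3 G)%:R - 2%:R / 3%:R :> rat].
Proof.
have le_mu (H : sgraph) : (mu 3 H <= mu 3 (line_graph H))%N.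
  exact: leq_trans (mu_le_tau_line H) (tau_le_mu _ _).
split; first exact: mu_le_tau_line.
  by apply: affine_le_of_leq.
(* The chain is [tau 3 G], [mu 3 G], [mu 3] of the line graph, and [tau 3] of the iterated line
   graph. *)
apply: affine_le_of_leq => //; apply: leq_trans (tau_le_mu G 3) _.
exact: leq_trans (le_mu G) (mu_le_tau_line _).
Qed.
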